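(* Let $n\ge1$. For any finite birack $X$, abelian group $A$ and birack 2-cocycle $\phi:X\times X\to A$, the function $\mathcal{BCQ}_X^{\phi}$ from diagrams of $n$-strand braids to vertex-weighted quivers, $B\mapsto\mathcal{BCQ}_X^{\phi}(B)$, is an invariant of braids; that is, if $B$ and $B'$ are $n$-strand braid diagrams related by a finite sequence of braid Reidemeister moves, then $\mathcal{BCQ}_X^{\phi}(B)=\mathcal{BCQ}_X^{\phi}(B')$ as vertex-weighted quivers.
   Context: A birack is a set $X$ with binary operations $\underline{\triangleright},\overline{\triangleright}:X\times X\to X$ such that: (i) for all $y\in X$ the maps $\alpha_y(x)=x\mathbin{\overline{\triangleright}}y$ and $\beta_y(x)=x\mathbin{\underline{\triangleright}}y$ are bijections of $X$; (ii) the map $S(x,y)=(y\mathbin{\overline{\triangleright}}x,\;x\mathbin{\underline{\triangleright}}y)$ is a bijection of $X\times X$; (iii) for all $x,y,z\in X$: $(x\mathbin{\underline{\triangleright}}y)\mathbin{\underline{\triangleright}}(z\mathbin{\underline{\triangleright}}y)=(x\mathbin{\underline{\triangleright}}z)\mathbin{\underline{\triangleright}}(y\mathbin{\overline{\triangleright}}z)$, $(x\mathbin{\underline{\triangleright}}y)\mathbin{\overline{\triangleright}}(z\mathbin{\underline{\triangleright}}y)=(x\mathbin{\overline{\triangleright}}z)\mathbin{\underline{\triangleright}}(y\mathbin{\overline{\triangleright}}z)$, $(x\mathbin{\overline{\triangleright}}y)\mathbin{\overline{\triangleright}}(z\mathbin{\overline{\triangleright}}y)=(x\mathbin{\overline{\triangleright}}z)\mathbin{\overline{\triangleright}}(y\mathbin{\underline{\triangleright}}z)$.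 A birack determines a bijection $\rho:X\times X\to X\times X$, $\rho(x,y)=(\alpha_x^{-1}(y),\;x\mathbin{\underline{\triangleright}}\alpha_x^{-1}(y))$, which satisfies the set-theoretic Yang-Baxter equation (so $(X,\rho)$ is a switch); equivalently $\rho(x,\,y\mathbin{\overline{\triangleright}}x)=(y,\,x\mathbin{\underline{\triangleright}}y)$. The birack boundary maps $\partial_k:A[X^k]\to A[X^{k-1}]$ are given by $\partial_k(x_1,\dots,x_k)=\sum_{j=1}^k(-1)^j[(x_1,\dots,x_{j-1},x_{j+1},\dots,x_k)-(x_1\mathbin{\underline{\triangleright}}x_j,\dots,x_{j-1}\mathbin{\underline{\triangleright}}x_j,x_{j+1}\mathbin{\overline{\triangleright}}x_j,\dots,x_k\mathbin{\overline{\triangleright}}x_j)]$. A birack 2-cocycle is a function $\phi:X\times X\to A$ whose coboundary (dual to $\partial_3$) vanishes, i.e. for all $x,y,z\in X$: $\phi(y,z)+\phi(x\mathbin{\underline{\triangleright}}y,\,z\mathbin{\overline{\triangleright}}y)+\phi(x,y)=\phi(y\mathbin{\overline{\triangleright}}x,\,z\mathbin{\overline{\triangleright}}x)+\phi(x,z)+\phi(x\mathbin{\underline{\triangleright}}z,\,y\mathbin{\underline{\triangleright}}z)$. An $n$-strand braid diagram $B$ is (up to planar isotopy) a word in $\sigma_1^{\pm1},\dots,\sigma_{n-1}^{\pm1}$ read from top to bottom, where $\sigma_i$ denotes a positive crossing of the strands in positions $i,i+1$; planar isotopy allows $\sigma_i^{\pm1}\sigma_j^{\pm1}=\sigma_j^{\pm1}\sigma_i^{\pm1}$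 (any signs) for $|i-j|\ge2$. The braid Reidemeister moves are the direct Reidemeister II moves (inserting or deleting $\sigma_i\sigma_i^{-1}$ or $\sigma_i^{-1}\sigma_i$) and the Reidemeister III moves ($\sigma_i\sigma_{i+1}\sigma_i\leftrightarrow\sigma_{i+1}\sigma_i\sigma_{i+1}$ and its variants with other crossing signs). A vector $v\in X^n$ of colors at the top of $B$ determines a coloring of all semiarcs of $B$ by propagating downwards: at $\sigma_i$ the colors $(p,q)$ in positions $i,i+1$ above the crossing become $\rho(p,q)$ below it, and at $\sigma_i^{-1}$ they become $\rho^{-1}(p,q)$. The resulting bottom vector is $\varphi_B(v)$. The switch braid quiver $\mathcal{SQ}_X(B)$ has vertex set $X^n$ and a directed edge from $\overline{x}$ to $\overline{y}$ if and only if $\varphi_B(\overline{x})=\overline{y}$. For a crossing $c$ of $B$ colored in this way, let $(x(c),y(c))$ be the pair of colors on the left of the crossing (i.e. in position $i$): $x(c)$ is the top-left and $y(c)$ the bottom-left color at a positive crossing, and $x(c)$ is the bottom-left and $y(c)$ the top-left color at a negative crossing. The Boltzmann weight of $v$ is $BW(v)=\sum_{c}\pm\phi(x(c),y(c))\in A$, with sign $+$ at positive crossings and $-$ at negative crossings. The birack braid cocycle quiver $\mathcal{BCQ}_X^{\phi}(B)$ is $\mathcal{SQ}_X(B)$ with each vertex $v$ given the weight $BW(v)$. *)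

(* Defs.v *)
From HB Require Import structures.
From Stdlib Require Export Relation_Operators.
From mathcomp Require Export all_boot all_order all_algebra.
#[export] Set Implicit Arguments.
#[export] Unset Strict Implicit.
#[export] Unset Printing Implicit Defensive.
Import GRing.Theory.
Local Open Scope ring_scope.

(* [un x y] and [ov x y] are the underlined and overlined triangle operations. *)
Record is_birack (X : Type) (un ov : X -> X -> X) : Prop := IsBirack {
  birack_ov_bij : forall y, bijective (fun x => ov x y);
  birack_un_bij : forall y, bijective (fun x => un x y);
  birack_S_bij : bijective (fun p : X * X => (ov p.2 p.1, un p.1 p.2));
  birack_un_un : forall x y z,
    un (un x y) (un z y) = un (un x z) (ov y z);
  birack_un_ov : forall x y z,
    ov (un x y) (un z y) = un (ov x z) (ov y z);
  birack_ov_ov : forall x y z,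
    ov (ov x y) (ov z y) = ov (ov x z) (un y z)
}.

Record finBirack := FinBirack {
  birack_sort :> finType;
  under : birack_sort -> birack_sort -> birack_sort;
  over : birack_sort -> birack_sort -> birack_sort;
  birackP : is_birack under over
}.

Section Birack.
Variable X : finBirack.

Definition alpha (y x : X) : X := over x y.

Lemma alpha_inj y : injective (alpha y).
Proof. exact: bij_inj (birack_ov_bij (birackP X) y). Qed.

Definition alpha_inv (y : X) : X -> X := invF (@alpha_inj y).

Definition rho (p : X * X) : X * X :=
  (alpha_inv p.1 p.2, under p.1 (alpha_inv p.1 p.2)).

Lemma rho_inj : injective rho.
Proof.
move=> [x y] [x' y'] [/= eqa equ]; move: equ; rewrite -eqa => equ.
have eqx := bij_inj (birack_un_bij (birackP X) _) equ.
move: eqa; rewrite -eqx => eqa; congr pair.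
by rewrite -(f_invF (@alpha_inj x) y) -(f_invF (@alpha_inj x) y'); congr alpha.
Qed.

Definition rho_inv : X * X -> X * X := invF rho_inj.

Definition is_birack_2cocycle (A : zmodType) (phi : X * X -> A) : Prop :=
  forall x y z : X,
    phi (y, z) + phi (under x y, over z y) + phi (x, y) =
    phi (over y x, over z x) + phi (x, z) + phi (under x z, under y z).

End Birack.

(* The crossing [(i, true)] is sigma_(i+1) and [(i, false)] is its inverse; the
   generators of the n-strand diagrams are thus indexed from 0 to n - 2, and
   words are read from top to bottom. *)
Definition crossing (n : nat) : Type := ('I_n.-1 * bool)%type.
Definition braid_word (n : nat) : Type := seq (crossing n).

Lemma right_pos_subproof n (i : 'I_n.-1) : (i.+1 < n)%N.
Proof. by rewrite -ltn_predRL. Qed.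

Definition left_pos n (i : 'I_n.-1) : 'I_n := widen_ord (leq_pred n) i.
Definition right_pos n (i : 'I_n.-1) : 'I_n := Ordinal (right_pos_subproof i).

(* The condition on the signs in [Reidemeister3] excludes exactly the two
   alternating patterns + - + and - + -, for which the exchange is not an
   isotopy. The two sides range over all the other sign patterns, so reading
   the rule in both directions gives all the variants of the move. *)
Inductive local_move (n : nat) : braid_word n -> braid_word n -> Prop :=
| PlanarIsotopy (i j : 'I_n.-1) (a b : bool) :
    (i.+1 < j)%N || (j.+1 < i)%N ->
    local_move [:: (i, a); (j, b)] [:: (j, b); (i, a)]
| Reidemeister2 (i : 'I_n.-1) (a : bool) :
    local_move [:: (i, a); (i, ~~ a)] [::]
| Reidemeister3 (i j : 'I_n.-1) (a b c : bool) :
    j = i.+1 :> nat -> (a == b) || (b == c) ->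
    local_move [:: (i, a); (j, b); (i, c)] [:: (j, c); (i, b); (j, a)].

Inductive braid_move (n : nat) : braid_word n -> braid_word n -> Prop :=
| BraidMove (top u v bottom : braid_word n) :
    local_move u v -> braid_move (top ++ u ++ bottom) (top ++ v ++ bottom).

Definition braid_equiv (n : nat) : braid_word n -> braid_word n -> Prop :=
  clos_refl_sym_trans (braid_word n) (@braid_move n).

Section Coloring.
Variables (X : finBirack) (n : nat).
Implicit Types (c : crossing n) (v : {ffun 'I_n -> X}) (B : braid_word n).

Definition cross c v : {ffun 'I_n -> X} :=
  let p := (v (left_pos c.1), v (right_pos c.1)) in
  let q := if c.2 then rho p else rho_inv p in
  [ffun k => if k == left_pos c.1 then q.1
             else if k == right_pos c.1 then q.2 else v k].

Fixpoint propagate B v : {ffun 'I_n -> X} :=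
  if B is c :: B' then propagate B' (cross c v) else v.

Variables (A : zmodType) (phi : X * X -> A).

(* [v] colors the strands just above the crossing [c]. *)
Definition crossing_weight c v : A :=
  let above := v (left_pos c.1) in
  let below := cross c v (left_pos c.1) in
  if c.2 then phi (above, below) else - phi (below, above).

Fixpoint boltzmann_weight B v : A :=
  if B is c :: B' then crossing_weight c v + boltzmann_weight B' (cross c v)
  else 0.

End Coloring.

(* The quivers at hand have at most one arrow from one vertex to another, so
   their arrows are given by a set of ordered pairs of vertices. *)
Record quiver := Quiver {
  vertex : finType;
  arrows : {set vertex * vertex}
}.

Record weighted_quiver (A : Type) := WeightedQuiver {
  base_quiver :> quiver;
  vertex_weight : {ffun vertex base_quiver -> A}
}.

Definition SQ (X : finBirack) (n : nat) (B : braid_word n) : quiver :=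
  @Quiver {ffun 'I_n -> X} [set e | propagate B e.1 == e.2].

Definition BCQ (X : finBirack) (A : zmodType) (phi : X * X -> A) (n : nat)
    (B : braid_word n) : weighted_quiver A :=
  @WeightedQuiver A (SQ X B)
    [ffun v : {ffun 'I_n -> X} => boltzmann_weight phi B v].

(* Main.v *)
Require Import Defs.
From mathcomp Require Import zify.
Import GRing.Theory.

(** Reading a diagram downwards composes the colour maps of its crossings and
    adds up their weights. Both are determined piece by piece, so replacing a
    piece of a diagram by one with the same effect (the same colour map and the
    same weight, as functions of the colours above it) changes neither the
    arrows nor the vertex weights of the quiver. The theorem thus reduces to
    the local moves ([same_effect_local_move]).

    Distant crossings commute because each neither reads nor changes the
    colours of the other. In a Reidemeister II move the two crossings apply
    [rho] and its inverse and carry the same pair of colours on the left, so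
    their weights cancel.

    For the Reidemeister III move with three positive crossings, the colours
    are best expressed by those in the leftmost position of
    sigma_i sigma_(i+1) sigma_i, say x, y, z from top to bottom. The top
    colours are then x, over y x and over (over z y) (under x y), and each
    crossing can be read off from rho (x, over y x) = (y, under x y) without
    inverting anything. The three birack identities make the colours of the
    other side fit together and end in the same bottom colours, and the two
    total weights are the two sides of the 2-cocycle condition
    ([same_effect_R3_pos]).

    The other signs need no new computation: [same_effect] is a congruence for
    which the crossings are invertible, so moving an outer crossing of each
    side, inverted, to the same end of the other side turns one sign pattern
    into another ([same_effect_R3_shift]). The non-alternating patterns form a single orbit
    under such shifts. *)

Section Effect.
Local Open Scope ring_scope.

Variables (X : finBirack) (n : nat) (A : zmodType) (phi : X * X -> A).
Implicit Types (v : {ffun 'I_n -> X}) (B : braid_word n) (i j : 'I_n.-1).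

Definition same_effect (B1 B2 : braid_word n) : Prop :=
  forall v, propagate B1 v = propagate B2 v
    /\ boltzmann_weight phi B1 v = boltzmann_weight phi B2 v.

Lemma same_effect_refl B : same_effect B B.
Proof. by []. Qed.

Lemma same_effect_sym B1 B2 : same_effect B1 B2 -> same_effect B2 B1.
Proof. by move=> e12 v; have [-> ->] := e12 v. Qed.

Lemma same_effect_trans B2 B1 B3 :
  same_effect B1 B2 -> same_effect B2 B3 -> same_effect B1 B3.
Proof. by move=> e12 e23 v; have [-> ->] := e12 v; apply: e23. Qed.

Lemma propagate_cat B1 B2 v :
  propagate (B1 ++ B2) v = propagate B2 (propagate B1 v).
Proof. by elim: B1 v => //= c B1 IH v. Qed.

Lemma boltzmann_weight_cat B1 B2 v :
  boltzmann_weight phi (B1 ++ B2) v =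
  boltzmann_weight phi B1 v + boltzmann_weight phi B2 (propagate B1 v).
Proof. by elim: B1 v => [|c B1 IH] v /=; rewrite ?add0r // IH addrA. Qed.

Lemma same_effect_cat B1 B1' B2 B2' :
  same_effect B1 B1' -> same_effect B2 B2' ->
  same_effect (B1 ++ B2) (B1' ++ B2').
Proof.
move=> e1 e2 v; rewrite !propagate_cat !boltzmann_weight_cat.
by have [-> ->] := e1 v; have [-> ->] := e2 (propagate B1' v).
Qed.

Lemma left_neq_right i : (left_pos i == right_pos i) = false.
Proof. by apply/eqP => /(congr1 val) /= /n_Sn. Qed.

Lemma cross_far c v (k : 'I_n) :
  k != left_pos c.1 -> k != right_pos c.1 -> cross c v k = v k.
Proof. by move=> /negbTE nl /negbTE nr; rewrite ffunE nl nr. Qed.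

Lemma crossK i b v : cross (i, ~~ b) (cross (i, b) v) = v.
Proof.
have rK p : (if ~~ b then @rho X else @rho_inv X)
    ((if b then @rho X else @rho_inv X) p) = p.
  by case: b; [apply: (invF_f (@rho_inj X)) | apply: (f_invF (@rho_inj X))].
apply/ffunP=> k; rewrite /cross !ffunE.
(* Simplification must not unfold [rho] applied to a pair. *)
move: (@rho X) (@rho_inv X) rK => r r' rK.
rewrite /= !eqxx (eq_sym (right_pos i)) left_neq_right.
have := rK (v (left_pos i), v (right_pos i)).
case: b {rK} => /=; rewrite -surjective_pairing => ->;
  by case: eqP => [->//|_]; case: eqP => [->|].
Qed.

(** The pair of colours that determines the weight is ordered by the sign:
    the colour above the first crossing of the move is the colour below the
    second, so both crossings evaluate [phi] at the same pair. *)
Lemma same_effect_R2 i b : same_effect [:: (i, b); (i, ~~ b)] [::].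
Proof.
move=> v; split; first exact: crossK.
by rewrite /= addr0 /crossing_weight crossK /=; case: b; rewrite /= ?addrN ?addNr.
Qed.

(** Crossings that share no position are disjoint updates of the colour
    vector, and the weight of each depends only on its own two positions. *)
Lemma same_effect_far i j (a b : bool) : (i.+1 < j)%N || (j.+1 < i)%N ->
  same_effect [:: (i, a); (j, b)] [:: (j, b); (i, a)].
Proof.
move=> far v.
have [LL LR RL RR] : [/\ left_pos i != left_pos j, left_pos i != right_pos j,
    right_pos i != left_pos j & right_pos i != right_pos j].
  by split; apply/eqP => /(congr1 val) /= eqij; lia.
have comm : cross (j, b) (cross (i, a) v) = cross (i, a) (cross (j, b) v).
  apply/ffunP=> k; have [kli|nli] := eqVneq k (left_pos i).
    rewrite cross_far ?kli // [RHS]ffunE [LHS]ffunE /= eqxx.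
    by rewrite !(@cross_far (j, b)).
  have [kri|nri] := eqVneq k (right_pos i).
    rewrite cross_far ?kri // [RHS]ffunE [LHS]ffunE /= eqxx.
    by rewrite !(@cross_far (j, b)).
  rewrite [RHS]cross_far // !ffunE /= !(negbTE nli) !(negbTE nri).
  by rewrite !(eq_sym (left_pos j)) !(eq_sym (right_pos j))
    (negbTE LL) (negbTE LR) (negbTE RL) (negbTE RR).
split=> //=; rewrite !addr0 addrC /crossing_weight /= comm.
rewrite (@cross_far (i, a) _ (left_pos j)) ?(eq_sym (left_pos j)) //.
rewrite (@cross_far (i, a) _ (left_pos j)) ?(eq_sym (left_pos j)) //.
by rewrite -comm !(@cross_far (j, b) _ (left_pos i)).
Qed.

(** The switch is explicit when its second argument is an over-product, so
    positive crossings are computed with top colours of this form. *)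
Lemma rhoE (x y : X) : rho (x, over y x) = (y, under x y).
Proof. by rewrite /rho /= [alpha_inv _ _](invF_f (@alpha_inj X x) y). Qed.

Lemma cross_pos i v x y :
  v (left_pos i) = x -> v (right_pos i) = over y x ->
  [/\ cross (i, true) v (left_pos i) = y,
      cross (i, true) v (right_pos i) = under x y
    & crossing_weight phi (i, true) v = phi (x, y)].
Proof.
move=> vl vr; rewrite /crossing_weight !ffunE [(_, true).1]/= vl vr rhoE.
by rewrite /= !eqxx eq_sym left_neq_right.
Qed.

(** With the leftmost colours of the first side named x, y, z, the weights are
    phi (x, y), phi (under x y, over z y), phi (y, z) on the first side and
    phi (over y x, over z x), phi (x, z), phi (under x z, under y z) on the
    second, so that their sums agree by the cocycle condition at (x, y, z). *)
Lemma same_effect_R3_pos i j : is_birack_2cocycle phi -> j = i.+1 :> nat ->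
  same_effect [:: (i, true); (j, true); (i, true)]
              [:: (j, true); (i, true); (j, true)].
Proof.
move=> phiC ji v.
have lj : left_pos j = right_pos i by apply: val_inj; rewrite /= ji.
set p0 := left_pos i; set p1 := right_pos i; set p2 := right_pos j.
have n01 : p0 != p1 by rewrite left_neq_right.
have n12 : p1 != p2 by rewrite /p1 -lj left_neq_right.
have n02 : p0 != p2 by rewrite -val_eqE /= ji neq_ltn leqnSn.
have ov_surj (c q : X) : exists y, over y c = q.
  by exists (alpha_inv c q); apply: (f_invF (@alpha_inj X c)).
pose x := v p0.
have [y v1] := ov_surj x (v p1); have [z' v2] := ov_surj (under x y) (v p2).
(* The third top colour is over (over z y) (under x y). *)
have [z zE] := ov_surj y z'; rewrite -{}zE in v2.
have PX := birackP X.
have [a0 a1 wa] := cross_pos (erefl x) (esym v1).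
set va := cross (i, true) v in a0 a1 wa.
have a2 : va p2 = v p2 by rewrite cross_far //= eq_sym.
have [] := @cross_pos j va (under x y) (over z y).
- by rewrite lj.
- by rewrite -/p2 a2.
set vb := cross (j, true) va => b1 b2 wb.
have b0 : vb p0 = y by rewrite cross_far //= lj.
have [] := @cross_pos i vb y z b0.
- by rewrite -b1 lj.
set vc := cross (i, true) vb => c0 c1 wc.
have c2 : vc p2 = under (under x y) (over z y).
  by rewrite cross_far //= eq_sym.
(* The second side starts at position j. Its colours are again of the form
   (x, over y x) by [birack_ov_ov] at its first crossing and by [birack_un_ov]
   at its last one. *)
have [] := @cross_pos j v (over y x) (over z x).
- by rewrite lj.
- by rewrite -/p2 -v2 -(birack_ov_ov PX).
set vd := cross (j, true) v => d1 d2 wd.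
have d0 : vd p0 = x by rewrite cross_far //= lj.
have [] := @cross_pos i vd x z d0.
- by rewrite -d1 lj.
set ve := cross (i, true) vd => e0 e1 we.
have e2 : ve p2 = under (over y x) (over z x).
  by rewrite cross_far //= eq_sym.
have [] := @cross_pos j ve (under x z) (under y z).
- by rewrite lj.
- by rewrite -/p2 e2 (birack_un_ov PX).
set vf := cross (j, true) ve => f1 f2 wf.
have f0 : vf p0 = z by rewrite cross_far //= lj.
split; last first.
  rewrite /= -/va -/vb -/vd -/ve wa wb wc wd we wf !addr0.
  have := phiC x y z; rewrite -!addrA => <-.
  by rewrite [LHS]addrC [phi (under x y, _) + phi (y, z)]addrC -addrA.
rewrite /= -/va -/vb -/vc -/vd -/ve -/vf; apply/ffunP=> k.
have [->|k0] := eqVneq k p0; first by rewrite [LHS]c0 f0.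
have [->|k1] := eqVneq k p1; first by rewrite [LHS]c1 -f1 lj.
have [->|k2] := eqVneq k p2; first by rewrite c2 [RHS]f2 (birack_un_un PX).
by rewrite /vc /vb /va /vf /ve /vd !cross_far //= ?lj.
Qed.

(** Multiplying both sides by the inverse of [(j, c)] on the left and of
    [(i, c)] on the right cancels the two crossings of sign [c], which reappear
    inverted on the other side. No order is assumed between [i] and [j]: by
    symmetry of [same_effect], the lemma with [i] and [j] exchanged does the
    same with the two crossings of sign [a]. *)
Lemma same_effect_R3_shift i j (a b c : bool) :
  same_effect [:: (i, a); (j, b); (i, c)] [:: (j, c); (i, b); (j, a)] ->
  same_effect [:: (i, b); (j, a); (i, ~~ c)] [:: (j, ~~ c); (i, a); (j, b)].
Proof.
move=> eR3.
(* Writing i^a for (i, a): up to cancelling pairs, the two words are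
   j^~~c (j^c i^b j^a) i^~~c and j^~~c (i^a j^b i^c) i^~~c, whose middle parts
   are the two sides of the hypothesis. *)
have cancel_top : same_effect [:: (j, ~~ c); (j, c)] [::].
  by rewrite -{2}[c]negbK; apply: same_effect_R2.
apply: (@same_effect_trans
  ([:: (j, ~~ c); (j, c)] ++ [:: (i, b); (j, a); (i, ~~ c)])).
  by apply/same_effect_sym/(same_effect_cat cancel_top)/same_effect_refl.
apply: (@same_effect_trans
  ([:: (j, ~~ c); (i, a); (j, b)] ++ [:: (i, c); (i, ~~ c)])).
  apply: (@same_effect_cat [:: (j, ~~ c)] [:: (j, ~~ c)]
    ([:: (j, c); (i, b); (j, a)] ++ [:: (i, ~~ c)])
    ([:: (i, a); (j, b); (i, c)] ++ [:: (i, ~~ c)])) => //.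
  exact/same_effect_cat/same_effect_refl/same_effect_sym.
by rewrite -[X in same_effect _ X]cats0;
  apply/same_effect_cat/same_effect_R2/same_effect_refl.
Qed.

Lemma same_effect_R3 i j (a b c : bool) :
  is_birack_2cocycle phi -> j = i.+1 :> nat -> (a == b) || (b == c) ->
  same_effect [:: (i, a); (j, b); (i, c)] [:: (j, c); (i, b); (j, a)].
Proof.
move=> phiC ji.
have shift_last := @same_effect_R3_shift i j.
have shift_first a' b' c' :
    same_effect [:: (i, a'); (j, b'); (i, c')]
                [:: (j, c'); (i, b'); (j, a')] ->
    same_effect [:: (i, ~~ a'); (j, c'); (i, b')]
                [:: (j, b'); (i, c'); (j, ~~ a')].
  by move=> e; apply/same_effect_sym/same_effect_R3_shift/same_effect_sym.
(* The letters give the signs of the three crossings of the first side. *)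
have ppp := same_effect_R3_pos phiC ji.
have ppn := shift_last _ _ _ ppp.
have npp := shift_first _ _ _ ppp.
have nnp := shift_first _ _ _ ppn.
have pnn := shift_last _ _ _ npp.
have nnn := shift_last _ _ _ nnp.
by case: a; case: b; case: c.
Qed.

Lemma same_effect_local_move B1 B2 :
  is_birack_2cocycle phi -> local_move B1 B2 -> same_effect B1 B2.
Proof.
move=> phiC [i j a b|i a|i j a b c]; first exact: same_effect_far.
  exact: same_effect_R2.
exact: same_effect_R3.
Qed.

Lemma same_effect_braid_equiv B1 B2 :
  is_birack_2cocycle phi -> braid_equiv B1 B2 -> same_effect B1 B2.
Proof.
move=> phiC; elim=> {B1 B2} [_ _ [top u v bottom uv]|B|B1 B2 _|B1 B2 B3 _ e12 _].
- apply: same_effect_cat => //; apply: same_effect_cat => //.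
  exact: same_effect_local_move.
- exact: same_effect_refl.
- exact: same_effect_sym.
- exact: same_effect_trans.
Qed.

Lemma same_effect_BCQ B1 B2 : same_effect B1 B2 -> BCQ phi B1 = BCQ phi B2.
Proof.
move=> e12; rewrite /BCQ /SQ.
have -> : [set e : {ffun 'I_n -> X} * {ffun 'I_n -> X} | propagate B1 e.1 == e.2]
    = [set e | propagate B2 e.1 == e.2].
  by apply/setP=> e; rewrite !inE; have [-> _] := e12 e.1.
by congr WeightedQuiver; apply/ffunP=> v; rewrite !ffunE; have [_ ->] := e12 v.
Qed.

End Effect.

Theorem theorem14 (n : nat) (hn : 0 < n) (X : finBirack) (A : zmodType)
    (phi : X * X -> A) (hphi : is_birack_2cocycle phi)
    (B B' : braid_word n) (hBB' : braid_equiv B B') :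
  BCQ phi B = BCQ phi B'.
Proof. exact/same_effect_BCQ/same_effect_braid_equiv. Qed.
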